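(* Let $G=\pi_1(X_K,x_0)$ be the group of a nontrivial tame knot $K\subset S^3$ with meridian $m\in G$, let $U\le G$ be a finite-index subgroup and let $M_U\trianglelefteq U$ be its ramification subgroup. Then the closure of $M_U$ in $\widehat U$ is the closed normal subgroup of $\widehat U$ generated by the closures of the inertia subgroups: $$\overline{M_U}^{\,\widehat U}=\overline{\left\langle\!\left\langle U\cap g\langle m\rangle g^{-1}:\ g\in G\right\rangle\!\right\rangle_U}^{\,\widehat U}=\left\langle\!\left\langle \overline{U\cap g\langle m\rangle g^{-1}}^{\,\widehat U}:\ g\in G\right\rangle\!\right\rangle_{\widehat U}^{\mathrm{cl}} .$$
   Context: $K\subset S^3$ is a nontrivial tame knot, $\nu(K)$ is a tubular neighbourhood of $K$, $X_K=S^3\setminus\operatorname{int}(\nu(K))$ is the knot exterior, $x_0\in\partial X_K$ is a basepoint, and $G=\pi_1(X_K,x_0)$. A meridian is an element of $\pi_1(\partial X_K,x_0)$ represented by a simple closed curve on the torus $\partial X_K$ bounding an embedded disk in $\nu(K)$ that meets $K$ once; $m\in G$ denotes the image of a chosen meridian under the map induced by inclusion $\partial X_K\hookrightarrow X_K$. For a finite-index subgroup $U\le G$ and $g\in G$, the meridional inertia subgroup is $I_g(U):=U\cap g\langle m\rangle g^{-1}$. The ramification subgroup $M_U$ of $U$ is the normal closure in $U$ of $\bigcup_{g\in G}I_g(U)$, i.e. the smallest normal subgroup of $U$ containing every $I_g(U)$. $\widehat G$ and $\widehat U$ are the profinite completions; $G$ is viewed as a dense subgroup of $\widehat G$, and $\widehat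 U$ is identified with the closure of $U$ in $\widehat G$, which is an open subgroup of $\widehat G$. For $H\subseteq U$, $\overline{H}^{\,\widehat U}$ is the closure of $H$ in $\widehat U$. $\langle\!\langle\cdot\rangle\!\rangle_U$ denotes the normal closure in $U$ of the union of the listed subsets, and $\langle\!\langle\cdot\rangle\!\rangle_{\widehat U}^{\mathrm{cl}}$ denotes the topological closure of the normal closure in $\widehat U$ of the union of the listed subsets. *)

(* Defs.v *)
From HB Require Import structures.
From mathcomp Require Import all_boot all_order all_algebra generic_quotient.
From mathcomp Require Import all_classical all_reals topology normedtype.
From mathcomp Require Import continuous_path.
From mathcomp Require Import ring lra.
Set Implicit Arguments.
Unset Strict Implicit.
Unset Printing Implicit Defensive.
Import Order.TTheory GRing.Theory Num.Theory.
Import numFieldNormedType.Exports.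
Local Open Scope classical_set_scope.
Local Open Scope quotient_scope.
Local Open Scope ring_scope.

Section Groups.
Local Open Scope group_scope.
Variable G : groupType.
Implicit Types (H U N S : set G) (g m : G).

Definition subgroup H : Prop := group_closed (mem H).

Definition finite_index H : Prop :=
  finite_set (range (fun g => [set g * h | h in H])).

Definition normal_in U N : Prop :=
  [/\ subgroup N, N `<=` U & forall u n, U u -> N n -> N (n ^ u)].

Definition normal_closure U S : set G := smallest (normal_in U) S.

Definition cyclic_subgroup m : set G := smallest subgroup [set m].

Definition inertia m U g : set G :=
  U `&` [set g * x * g^-1 | x in cyclic_subgroup m].

Definition ramification m U : set G :=
  normal_closure U (\bigcup_g inertia m U g).

End Groups.

(* Closure of B relative to A; only meaningful for B included in A. *)
Definition closure_in (T : topologicalType) (A B : set T) : set T :=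
  closure (B : set (subspace A)).

Section CosetGroup.
Local Open Scope group_scope.
Variable G : groupType.

Record finNormal := FinNormal {
  finNormal_set :> set G;
  finNormal_normal : normal_in setT finNormal_set;
  finNormal_index : finite_index finNormal_set
}.

Variable N : finNormal.

Definition coset_eq (x y : G) : bool := (x^-1 * y \in (N : set G)).

Let N1 : (N : set G) 1.
Proof. by case: (finNormal_normal N) => -[/set_mem]. Qed.

Let NF x y : (N : set G) x -> (N : set G) y -> (N : set G) (x / y).
Proof.
by case: (finNormal_normal N) => -[_ c] _ _ Nx Ny; apply/set_mem/c; exact/mem_set.
Qed.

Let NV x : (N : set G) x -> (N : set G) x^-1.
Proof. by rewrite -(div1g x); exact: NF. Qed.

Let NM x y : (N : set G) x -> (N : set G) y -> (N : set G) (x * y).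
Proof. by move=> Nx /NV Ny; rewrite -(invgK y); exact: NF. Qed.

Let NJ x y : (N : set G) x -> (N : set G) (x ^ y).
Proof. by case: (finNormal_normal N) => _ _; apply. Qed.

Lemma coset_eqxx : reflexive coset_eq.
Proof. by move=> x; rewrite /coset_eq; apply/mem_set; rewrite mulVg. Qed.

Lemma coset_eq_sym : symmetric coset_eq.
Proof.
by move=> x y; apply/idP/idP => /set_mem/NV; rewrite invgM invgK => /mem_set.
Qed.

Lemma coset_eq_trans : transitive coset_eq.
Proof.
move=> y x z /set_mem xy /set_mem yz; apply/mem_set.
by have := NM xy yz; rewrite mulgA mulgK.
Qed.

Canonical coset_equiv : equiv_rel G :=
  EquivRel coset_eq coset_eqxx coset_eq_sym coset_eq_trans.

Definition coset_group : Type := {eq_quot coset_equiv}.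

HB.instance Definition _ := Choice.on coset_group.

Definition coset_proj (x : G) : coset_group := \pi_({eq_quot coset_equiv}) x.
Definition coset_rep (c : coset_group) : G := repr (c : {eq_quot coset_equiv}).

Lemma coset_repK : cancel coset_rep coset_proj.
Proof. by move=> c; exact: (@reprK _ {eq_quot coset_equiv}). Qed.

Lemma coset_projP x y : coset_proj x = coset_proj y <-> (N : set G) (x^-1 * y).
Proof.
split=> [/eqmodP/set_mem//|xy].
by apply/eqmodP; exact/mem_set.
Qed.

Lemma coset_rep_proj x : (N : set G) (x^-1 * coset_rep (coset_proj x)).
Proof. by apply/coset_projP; rewrite coset_repK. Qed.

Definition coset_mul c d : coset_group := coset_proj (coset_rep c * coset_rep d).
Definition coset_inv c : coset_group := coset_proj (coset_rep c)^-1.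

Lemma coset_projM x y :
  coset_proj (x * y) = coset_mul (coset_proj x) (coset_proj y).
Proof.
apply/coset_projP.
have Nx := coset_rep_proj x; have Ny := coset_rep_proj y.
have := NM (NJ y Nx) Ny.
by rewrite conjgE invgM !mulgA mulgK.
Qed.

Lemma coset_projV x : coset_proj x^-1 = coset_inv (coset_proj x).
Proof.
apply/coset_projP; have := NV (NJ x^-1 (coset_rep_proj x)).
by rewrite conjgE !invgK !mulgA mulgV mul1g invgM !invgK.
Qed.

Lemma coset_mulA : associative coset_mul.
Proof.
move=> a b c; rewrite -(coset_repK a) -(coset_repK b) -(coset_repK c).
by rewrite -!coset_projM mulgA.
Qed.
Lemma coset_mul1 : left_id (coset_proj 1) coset_mul.
Proof. by move=> a; rewrite -(coset_repK a) -coset_projM mul1g. Qed.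
Lemma coset_mulr1 : right_id (coset_proj 1) coset_mul.
Proof. by move=> a; rewrite -(coset_repK a) -coset_projM mulg1. Qed.
Lemma coset_mulV : left_inverse (coset_proj 1) coset_inv coset_mul.
Proof.
by move=> a; rewrite -(coset_repK a) -coset_projV -coset_projM mulVg.
Qed.
Lemma coset_mulVr : right_inverse (coset_proj 1) coset_inv coset_mul.
Proof.
by move=> a; rewrite -(coset_repK a) -coset_projV -coset_projM mulgV.
Qed.

HB.instance Definition _ := isGroup.Build coset_group
  coset_mulA coset_mul1 coset_mulr1 coset_mulV coset_mulVr.

HB.instance Definition _ := Topological.copy coset_group
  (discrete_topology coset_group).

End CosetGroup.

Section Profinite.
Local Open Scope group_scope.
Variable G : groupType.

Definition coset_trans (M N : finNormal G) (c : coset_group M) : coset_group N :=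
  coset_proj N (coset_rep c).

(* The inverse limit of the finite quotients of G, the product being that of
   discrete spaces. *)
Definition compatible :
    set (prod_topology (fun N : finNormal G => coset_group N : topologicalType)) :=
  [set x | forall M N : finNormal G, (M : set G) `<=` N ->
    coset_trans N (x M) = x N].

Definition profinite_completion : Type := set_type compatible.

HB.instance Definition _ := Topological.on profinite_completion.

Lemma coset_trans_proj (M N : finNormal G) g : (M : set G) `<=` N ->
  coset_trans N (coset_proj M g) = coset_proj N g.
Proof.
by move=> MN; apply/esym/coset_projP/MN; exact: coset_rep_proj.
Qed.

Lemma coset_transM (M N : finNormal G) (c d : coset_group M) : (M : set G) `<=` N ->
  coset_trans N (c * d) = coset_trans N c * coset_trans N d.
Proof.
move=> MN; rewrite -[c]coset_repK -[d]coset_repK -[_ * _]coset_projM.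
by rewrite !coset_trans_proj// coset_projM.
Qed.

Lemma coset_transV (M N : finNormal G) (c : coset_group M) : (M : set G) `<=` N ->
  coset_trans N c^-1 = (coset_trans N c)^-1.
Proof.
move=> MN; rewrite -[c]coset_repK -[_^-1]coset_projV.
by rewrite !coset_trans_proj// coset_projV.
Qed.

Implicit Types x y z : profinite_completion.

Lemma compatibleP x : compatible (\val x).
Proof. exact/set_mem/(valP x). Qed.

Lemma to_profinite_subproof (g : G) : compatible (fun N => coset_proj N g).
Proof. by move=> M N MN; exact: coset_trans_proj. Qed.

Definition to_profinite (g : G) : profinite_completion :=
  SigSub (mem_set (to_profinite_subproof g)).

Lemma pmul_subproof x y : compatible (fun N => \val x N * \val y N).
Proof.
by move=> M N MN; rewrite coset_transM// !compatibleP.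
Qed.

Lemma pinv_subproof x : compatible (fun N => (\val x N)^-1).
Proof. by move=> M N MN; rewrite coset_transV// compatibleP. Qed.

Definition pmul x y : profinite_completion := SigSub (mem_set (pmul_subproof x y)).
Definition pinv x : profinite_completion := SigSub (mem_set (pinv_subproof x)).

Lemma profinite_eqP x y : (forall N, \val x N = \val y N) -> x = y.
Proof. by move=> xy; apply: val_inj; exact: functional_extensionality_dep. Qed.

Lemma pmulA : associative pmul.
Proof. by move=> x y z; apply: profinite_eqP => N; exact: mulgA. Qed.
Lemma pmul1 : left_id (to_profinite 1) pmul.
Proof. by move=> x; apply: profinite_eqP => N; exact: mul1g. Qed.
Lemma pmulr1 : right_id (to_profinite 1) pmul.
Proof. by move=> x; apply: profinite_eqP => N; exact: mulg1. Qed.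
Lemma pmulV : left_inverse (to_profinite 1) pinv pmul.
Proof. by move=> x; apply: profinite_eqP => N; exact: mulVg. Qed.
Lemma pmulVr : right_inverse (to_profinite 1) pinv pmul.
Proof. by move=> x; apply: profinite_eqP => N; exact: mulgV. Qed.

HB.instance Definition _ := isGroup.Build profinite_completion
  pmulA pmul1 pmulr1 pmulV pmulVr.

(* For U of finite index, the canonical map from the profinite completion of U
   to that of G is a homeomorphism onto this closure. *)
Definition profinite_sub (U : set G) : set profinite_completion :=
  closure (to_profinite @` U).

End Profinite.

Section UnitInterval.
Variable R : realType.

Definition unit_interval : Type := set_type (`[0%R, 1%R]%classic : set R).

HB.instance Definition _ := Topological.on unit_interval.

Let I := unit_interval.

Let clamp_subproof (r : R) : `[0%R, 1%R]%classic (Num.max 0 (Num.min 1 r)).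
Proof. by rewrite /= in_itv/= le_max lexx/= ge_max ler01 ge_min lexx. Qed.

Definition clamp (r : R) : unit_interval := SigSub (mem_set (clamp_subproof r)).

Lemma clampE r : 0 <= r <= 1 -> \val (clamp r) = r.
Proof. by move=> /andP[r0 r1]; rewrite /= min_r// max_r. Qed.

Lemma unit_itvP (t : unit_interval) : 0 <= \val t <= 1.
Proof. by have /set_mem := valP t; rewrite /= in_itv. Qed.

Lemma clampK : cancel (fun t : unit_interval => \val t) clamp.
Proof. by move=> t; apply/val_inj/clampE/unit_itvP. Qed.

Lemma clamp_continuous : continuous clamp.
Proof.
apply/continuous_comp_initial => r /=.
apply: (@continuous_max _ _ (cst 0)); first exact: cvg_cst.
by apply: continuous_min; [exact: cvg_cst|exact: cvg_id].
Qed.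

Lemma val_continuous : continuous (\val : unit_interval -> R).
Proof. exact: initial_continuous. Qed.

Let zero_one : clamp 0 != clamp 1.
Proof.
apply/eqP => /(congr1 val); rewrite !clampE ?lexx ?ler01// => /esym/eqP.
by rewrite oner_eq0.
Qed.

HB.instance Definition _ := isBiPointed.Build unit_interval zero_one.

End UnitInterval.

Section RealContinuity.
Variables (R : realType) (Y : topologicalType).
Implicit Types (c d : Y -> R).

Lemma rcst_cont (a : R) : continuous (fun _ : Y => a).
Proof. by move=> u; exact: cst_continuous. Qed.

Lemma rmul_cont c d : continuous c -> continuous d ->
  continuous (fun u => c u * d u).
Proof. by move=> cc cd u; apply: cvgM; [exact: cc|exact: cd]. Qed.

Lemma radd_cont c d : continuous c -> continuous d ->
  continuous (fun u => c u + d u).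
Proof. by move=> cc cd u; apply: cvgD; [exact: cc|exact: cd]. Qed.

Lemma rsub_cont c d : continuous c -> continuous d ->
  continuous (fun u => c u - d u).
Proof. by move=> cc cd u; apply: cvgB; [exact: cc|exact: cd]. Qed.

Lemma double_cont c : continuous c -> continuous (fun u => 2 * c u).
Proof. by move=> cc; apply: rmul_cont => //; exact: rcst_cont. Qed.

Lemma double1_cont c : continuous c -> continuous (fun u => 2 * c u - 1).
Proof.
by move=> cc; apply: rsub_cont; [exact: double_cont|exact: rcst_cont].
Qed.

Lemma onem_cont c : continuous c -> continuous (fun u => 1 - c u).
Proof. by move=> cc; apply: rsub_cont => //; exact: rcst_cont. Qed.

End RealContinuity.

Lemma pair_cont (Y A B : topologicalType) (f : Y -> A) (g : Y -> B) :
  continuous f -> continuous g -> continuous (fun u => (f u, g u)).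
Proof. by move=> cf cg u; apply: cvg_pair; [exact: cf|exact: cg]. Qed.

Section PathHomotopy.
Variables (R : realType) (X : topologicalType).
Local Notation I := (unit_interval R).

Lemma if_continuous (Y : topologicalType) (F G : Y -> X) (c : Y -> R) (a : R) :
  continuous F -> continuous G -> continuous c ->
  (forall u, c u = a -> F u = G u) ->
  continuous (fun u => if c u <= a then F u else G u).
Proof.
move=> cF cG cc FG.
have AB : [set u | c u <= a] `|` [set u | c u >= a] = setT.
  by apply/seteqP; split=> // y _; case: (leP (c y) a) => [?|/ltW ?]; [left|right].
apply/continuous_subspace_setT; rewrite -AB; apply: withinU_continuous.
- by apply: (preimage_closed (f := c) (D := [set r | r <= a])) => //;
    exact: closed_le.
- by apply: (preimage_closed (f := c) (D := [set r | r >= a])) => //;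
    exact: closed_ge.
- apply: (@subspace_eq_continuous _ _ _ F); last exact: continuous_subspaceT.
  by move=> y; rewrite inE /= /from_subspace => ->.
- apply: (@subspace_eq_continuous _ _ _ G); last exact: continuous_subspaceT.
  move=> y; rewrite inE/= /from_subspace => ay; case: ifPn => // ya.
  by apply/esym/FG/le_anti; rewrite ya.
Qed.

Lemma clamp_comp_continuous (Y : topologicalType) (f : I -> X) (p : Y -> R) :
  continuous f -> continuous p -> continuous (fun u => f (clamp (p u))).
Proof.
move=> cf cp u; apply: (@continuous_comp _ _ _ (@clamp R \o p) f); last exact: cf.
by apply: continuous_comp; [exact: cp|exact: clamp_continuous].
Qed.

Lemma clamp0 : clamp 0 = zero :> I. Proof. by []. Qed.
Lemma clamp1 : clamp 1 = one :> I. Proof. by []. Qed.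
Lemma val_zero : \val (zero : I) = 0 :> R.
Proof. by rewrite clampE// lexx ler01. Qed.
Lemma val_one : \val (one : I) = 1 :> R.
Proof. by rewrite clampE// lexx ler01. Qed.

Definition path_homotopic (x y : X) (f g : {path I from x to y in X}) : Prop :=
  exists H : I * I -> X,
    [/\ continuous H,
        forall s, H (s, zero) = f s /\ H (s, one) = g s &
        forall t, H (zero, t) = x /\ H (one, t) = y].

Section concat.
Variables (x y z : X) (f : {path I from x to y in X})
  (g : {path I from y to z in X}).

Definition concat_fun (t : I) : X :=
  if \val t <= 2^-1 then f (clamp (2 * \val t)) else g (clamp (2 * \val t - 1)).

Lemma concat_continuous : continuous concat_fun.
Proof.
apply: (@if_continuous _ (fun t : I => f (clamp (2 * \val t)))
   (fun t : I => g (clamp (2 * \val t - 1)))).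
- apply: clamp_comp_continuous; first exact: cts_fun.
  by apply: double_cont; exact: val_continuous.
- apply: clamp_comp_continuous; first exact: cts_fun.
  by apply: double1_cont; exact: val_continuous.
- exact: val_continuous.
- move=> t ->; rewrite divff ?pnatr_eq0// subrr clamp1 clamp0.
  by rewrite path_one path_zero.
Qed.

Lemma concat_zero : concat_fun zero = x.
Proof.
by rewrite /concat_fun val_zero invr_ge0 ler0n mulr0 clamp0 path_zero.
Qed.

Lemma concat_one : concat_fun one = z.
Proof.
rewrite /concat_fun val_one ifF; last by apply/negbTE; rewrite -ltNge; lra.
by rewrite (_ : 2 * 1 - 1 = 1) ?clamp1 ?path_one//; lra.
Qed.

Definition path_concat : {path I from x to z in X} :=
  mk_path concat_continuous concat_zero concat_one.

End concat.

Section reverse.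
Variables (x y : X) (f : {path I from x to y in X}).

Definition reverse_fun (t : I) : X := f (clamp (1 - \val t)).

Lemma reverse_continuous : continuous reverse_fun.
Proof.
apply: clamp_comp_continuous; first exact: cts_fun.
by apply: onem_cont; exact: val_continuous.
Qed.

Lemma reverse_zero : reverse_fun zero = y.
Proof. by rewrite /reverse_fun val_zero subr0 clamp1 path_one. Qed.

Lemma reverse_one : reverse_fun one = x.
Proof. by rewrite /reverse_fun val_one subrr clamp0 path_zero. Qed.

Definition path_reverse : {path I from y to x in X} :=
  mk_path reverse_continuous reverse_zero reverse_one.

End reverse.

Lemma path_homotopic_reparam (x y u v : X) (P Q : {path I from x to y in X})
    (f : {path I from u to v in X}) (p q : R -> R) :
  continuous p -> continuous q -> p 0 = q 0 -> p 1 = q 1 ->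
  (forall s : I, P s = f (clamp (p (\val s)))) ->
  (forall s : I, Q s = f (clamp (q (\val s)))) ->
  path_homotopic P Q.
Proof.
move=> cp cq pq0 pq1 Pp Qq.
have cv1 : continuous (fun st : I * I => \val st.1 : R).
  by move=> st; apply: (@continuous_comp _ _ _ fst);
    [exact: cvg_fst|exact: val_continuous].
have cv2 : continuous (fun st : I * I => \val st.2 : R).
  by move=> st; apply: (@continuous_comp _ _ _ snd);
    [exact: cvg_snd|exact: val_continuous].
exists (fun st => f (clamp ((1 - \val st.2) * p (\val st.1) +
  \val st.2 * q (\val st.1)))); split.
- apply: clamp_comp_continuous; first exact: cts_fun.
  apply: radd_cont; apply: rmul_cont.
  + exact: onem_cont.
  + by move=> st; apply: (@continuous_comp _ _ _ (fun st : I * I => \val st.1 : R) p);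
    [exact: cv1|exact: cp].
  + exact: cv2.
  + by move=> st; apply: (@continuous_comp _ _ _ (fun st : I * I => \val st.1 : R) q);
    [exact: cv1|exact: cq].
- move=> s; cbn [fst snd]; rewrite val_zero val_one Pp Qq.
  by split; congr (f (clamp _)); ring.
- move=> t; cbn [fst snd]; rewrite val_zero val_one -pq0 -pq1 -!mulrDl subrK !mul1r.
  by have := Pp zero; have := Pp one;
    rewrite val_zero val_one path_zero path_one => <- <-.
Qed.

Lemma path_homotopic_refl x y (f : {path I from x to y in X}) :
  path_homotopic f f.
Proof.
apply: (@path_homotopic_reparam _ _ _ _ _ _ f id id) => //.
all: try by move=> r; exact: cvg_id.
all: by move=> s; rewrite clampK.
Qed.

Lemma path_homotopic_sym x y (f g : {path I from x to y in X}) :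
  path_homotopic f g -> path_homotopic g f.
Proof.
move=> [H [cH H01 Hxy]].
exists (fun st => H (st.1, clamp (1 - \val st.2))); split.
- move=> st; apply: continuous_comp; last exact: cH.
  apply: pair_cont => {}st; first exact: cvg_fst.
  apply: (@continuous_comp _ _ _ (fun st : I * I => 1 - \val st.2) (@clamp R));
    last exact: clamp_continuous.
  apply: onem_cont => u.
  by apply: (@continuous_comp _ _ _ snd);
    [exact: cvg_snd|exact: val_continuous].
- by move=> s; cbn [fst snd]; rewrite val_zero val_one subr0 subrr; case: (H01 s).
- by move=> t; cbn [fst snd]; exact: Hxy.
Qed.

Lemma path_homotopic_trans x y (g f h : {path I from x to y in X}) :
  path_homotopic f g -> path_homotopic g h -> path_homotopic f h.
Proof.
move=> [H [cH H01 Hxy]] [K [cK K01 Kxy]].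
have cv2 : continuous (fun st : I * I => \val st.2 : R).
  by move=> st; apply: (@continuous_comp _ _ _ snd);
    [exact: cvg_snd|exact: val_continuous].
have cc (L : I * I -> X) (p : I * I -> R) : continuous L -> continuous p ->
    continuous (fun st => L (st.1, clamp (p st))).
  move=> cL cp st; apply: continuous_comp; last exact: cL.
  apply: pair_cont => {}st; first exact: cvg_fst.
  by apply: continuous_comp; [exact: cp|exact: clamp_continuous].
exists (fun st => if \val st.2 <= 2^-1 then H (st.1, clamp (2 * \val st.2))
                  else K (st.1, clamp (2 * \val st.2 - 1))); split.
- apply: (@if_continuous _ (fun st : I * I => H (st.1, clamp (2 * \val st.2)))
    (fun st => K (st.1, clamp (2 * \val st.2 - 1)))) => //.
  + by apply: cc => //; exact: double_cont.
  + by apply: cc => //; exact: double1_cont.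
  + move=> st ->; rewrite divff ?pnatr_eq0// subrr clamp1 clamp0.
    by rewrite (H01 _).2 (K01 _).1.
- move=> s; cbn [fst snd]; rewrite val_zero val_one; split.
    by rewrite invr_ge0 ler0n mulr0 clamp0 (H01 _).1.
  rewrite ifF; last by apply/negbTE; rewrite -ltNge; lra.
  by rewrite (_ : 2 * 1 - 1 = 1) ?clamp1 ?(K01 _).2//; lra.
- by move=> t; cbn [fst snd]; case: ifP => _; [exact: Hxy|exact: Kxy].
Qed.

Lemma path_concat_homotopic x y z (f f' : {path I from x to y in X})
    (g g' : {path I from y to z in X}) :
  path_homotopic f f' -> path_homotopic g g' ->
  path_homotopic (path_concat f g) (path_concat f' g').
Proof.
move=> [H [cH H01 Hxy]] [K [cK K01 Kxy]].
have cv1 : continuous (fun st : I * I => \val st.1 : R).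
  by move=> st; apply: (@continuous_comp _ _ _ fst);
    [exact: cvg_fst|exact: val_continuous].
have cc (L : I * I -> X) (p : I * I -> R) : continuous L -> continuous p ->
    continuous (fun st => L (clamp (p st), st.2)).
  move=> cL cp st; apply: continuous_comp; last exact: cL.
  apply: pair_cont => {}st; last exact: cvg_snd.
  by apply: continuous_comp; [exact: cp|exact: clamp_continuous].
exists (fun st => if \val st.1 <= 2^-1 then H (clamp (2 * \val st.1), st.2)
                  else K (clamp (2 * \val st.1 - 1), st.2)); split.
- apply: (@if_continuous _ (fun st : I * I => H (clamp (2 * \val st.1), st.2))
    (fun st => K (clamp (2 * \val st.1 - 1), st.2))) => //.
  + by apply: cc => //; exact: double_cont.
  + by apply: cc => //; exact: double1_cont.
  + move=> st ->; rewrite divff ?pnatr_eq0// subrr clamp1 clamp0.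
    by rewrite (Hxy _).2 (Kxy _).1.
- move=> s; rewrite /= /mk_path /concat_fun/=.
  by case: ifP => _; [exact: H01|exact: K01].
- move=> t; cbn [fst snd]; rewrite val_zero val_one; split.
    by rewrite invr_ge0 ler0n mulr0 clamp0 (Hxy _).1.
  rewrite ifF; last by apply/negbTE; rewrite -ltNge; lra.
  by rewrite (_ : 2 * 1 - 1 = 1) ?clamp1 ?(Kxy _).2//; lra.
Qed.

Lemma path_reverse_homotopic x y (f g : {path I from x to y in X}) :
  path_homotopic f g -> path_homotopic (path_reverse f) (path_reverse g).
Proof.
move=> [H [cH H01 Hxy]].
exists (fun st => H (clamp (1 - \val st.1), st.2)); split.
- move=> st; apply: continuous_comp; last exact: cH.
  apply: pair_cont => {}st; last exact: cvg_snd.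
  apply: (@continuous_comp _ _ _ (fun st : I * I => 1 - \val st.1) (@clamp R));
    last exact: clamp_continuous.
  apply: onem_cont => u.
  by apply: (@continuous_comp _ _ _ fst);
    [exact: cvg_fst|exact: val_continuous].
- by move=> s; exact: H01.
- by move=> t; cbn [fst snd]; rewrite val_zero val_one subr0 subrr; case: (Hxy t).
Qed.

End PathHomotopy.

Section FundamentalGroup.
Variables (R : realType) (X : topologicalType) (x0 : X).
Local Notation I := (unit_interval R).

Definition loop : Type := {path I from x0 to x0 in X}.

HB.instance Definition _ := Choice.on loop.

Implicit Types f g h : loop.

Definition loop_homotopic f g : bool := `[< path_homotopic f g >].

Lemma loop_homotopic_refl : reflexive loop_homotopic.
Proof. by move=> f; apply/asboolP; exact: path_homotopic_refl. Qed.

Lemma loop_homotopic_sym : symmetric loop_homotopic.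
Proof. by move=> f g; apply/asboolP/asboolP; exact: path_homotopic_sym. Qed.

Lemma loop_homotopic_trans : transitive loop_homotopic.
Proof.
move=> g f h /asboolP fg /asboolP gh; apply/asboolP.
exact: path_homotopic_trans fg gh.
Qed.

Canonical loop_equiv : equiv_rel loop := EquivRel loop_homotopic
  loop_homotopic_refl loop_homotopic_sym loop_homotopic_trans.

Definition pi1 : Type := {eq_quot loop_equiv}.

HB.instance Definition _ := Choice.on pi1.

Definition pi1_class f : pi1 := \pi_({eq_quot loop_equiv}) f.
Definition pi1_repr (a : pi1) : loop := repr (a : {eq_quot loop_equiv}).

Lemma pi1_reprK : cancel pi1_repr pi1_class.
Proof. by move=> a; exact: (@reprK _ {eq_quot loop_equiv}). Qed.

Lemma pi1_classP f g : pi1_class f = pi1_class g <-> path_homotopic f g.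
Proof.
by split=> [/eqmodP/asboolP//|fg]; apply/eqmodP/asboolP.
Qed.

Lemma pi1_repr_class f : path_homotopic (pi1_repr (pi1_class f)) f.
Proof. by apply/pi1_classP; rewrite pi1_reprK. Qed.

Definition pi1_mul (a b : pi1) : pi1 :=
  pi1_class (path_concat (pi1_repr a) (pi1_repr b)).
Definition pi1_inv (a : pi1) : pi1 := pi1_class (path_reverse (pi1_repr a)).
Definition pi1_one : pi1 := pi1_class (cst x0 : {path I from x0 to x0 in X}).

Lemma pi1_classM f g :
  pi1_mul (pi1_class f) (pi1_class g) = pi1_class (path_concat f g).
Proof.
by apply/pi1_classP; apply: path_concat_homotopic; exact: pi1_repr_class.
Qed.

Lemma pi1_classV f : pi1_inv (pi1_class f) = pi1_class (path_reverse f).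
Proof.
by apply/pi1_classP; apply: path_reverse_homotopic; exact: pi1_repr_class.
Qed.

Let concatE (f g : {path I from x0 to x0 in X}) (r : R) : 0 <= r <= 1 ->
  path_concat f g (clamp r) =
  if r <= 2^-1 then f (clamp (2 * r)) else g (clamp (2 * r - 1)).
Proof. by move=> r01; rewrite /path_concat/= /mk_path /concat_fun clampE. Qed.

Let id_cont : continuous (fun r : R => r).
Proof. by move=> r; exact: cvg_id. Qed.

Let max_cont (p q : R -> R) : continuous p -> continuous q ->
  continuous (fun r => Num.max (p r) (q r)).
Proof. by move=> cp cq r; apply: continuous_max; [exact: cp|exact: cq]. Qed.

Let min_cont (p q : R -> R) : continuous p -> continuous q ->
  continuous (fun r => Num.min (p r) (q r)).
Proof. by move=> cp cq r; apply: continuous_min; [exact: cp|exact: cq]. Qed.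

Let concatE' (f g : {path I from x0 to x0 in X}) (s : I) :
  path_concat f g s =
  if \val s <= 2^-1 then f (clamp (2 * \val s)) else g (clamp (2 * \val s - 1)).
Proof. by []. Qed.

Lemma pi1_mulA : associative pi1_mul.
Proof.
move=> a b c; rewrite -(pi1_reprK a) -(pi1_reprK b) -(pi1_reprK c).
move: (pi1_repr a) (pi1_repr b) (pi1_repr c) => f g h.
rewrite !pi1_classM; apply/pi1_classP.
apply: (@path_homotopic_reparam _ _ _ _ _ _ _ _
  (path_concat (path_concat f g) h)
  (fun r => Num.max (Num.max (2^-1 * r) (r - 4^-1)) (2 * r - 1)) id) => //.
- apply: max_cont; last exact: double1_cont.
  apply: max_cont; first by apply: rmul_cont => //; exact: rcst_cont.
  by apply: rsub_cont => //; exact: rcst_cont.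
- rewrite mulr0 sub0r (_ : Num.max 0 (- 4^-1) = 0) ?max_l//; lra.
- rewrite (_ : Num.max _ _ = 1)// max_r//; first lra.
  by rewrite ge_max; apply/andP; split; lra.
- move=> s; have /andP[s0 s1] := unit_itvP s; rewrite concatE'.
  set r := \val s in s0 s1 *.
  case: (leP r 2^-1) => r2.
    rewrite (@max_l _ _ _ (r - 4^-1)); last lra.
    rewrite max_l; last lra.
    rewrite concatE; last lra.
    rewrite ifT; last lra.
    rewrite concatE; last lra.
    rewrite ifT; last lra.
    by congr (f (clamp _)); lra.
  case: (leP r (3 / 4)) => r4.
    rewrite (@max_r _ _ _ (r - 4^-1)); last lra.
    rewrite max_l; last lra.
    rewrite concatE; last lra.
    rewrite ifT; last lra.
    rewrite concatE; last lra.
    rewrite ifT; last lra.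
    rewrite concatE; last lra.
    rewrite ifF; last by apply/negbTE; lra.
    by congr (g (clamp _)); lra.
  rewrite max_r; last by rewrite ge_max; apply/andP; split; lra.
  rewrite concatE; last lra.
  rewrite ifF; last by apply/negbTE; lra.
  rewrite concatE; last lra.
  by rewrite ifF; last by apply/negbTE; lra.
- by move=> s; rewrite clampK.
Qed.

Lemma pi1_mul1 : left_id pi1_one pi1_mul.
Proof.
move=> a; rewrite -(pi1_reprK a) /pi1_one; move: (pi1_repr a) => f.
rewrite pi1_classM; apply/pi1_classP.
apply: (@path_homotopic_reparam _ _ _ _ _ _ _ _ f
  (fun r => Num.max 0 (2 * r - 1)) id) => //.
- by apply: max_cont; [exact: rcst_cont|exact: double1_cont].
- by rewrite mulr0 sub0r max_l//; lra.
- by rewrite mulr1 max_r; lra.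
- move=> s; rewrite concatE'; set r := \val s; case: (leP r 2^-1) => r2.
    by rewrite max_l ?clamp0 ?path_zero//; lra.
  by rewrite max_r//; lra.
- by move=> s; rewrite clampK.
Qed.

Lemma pi1_mulr1 : right_id pi1_one pi1_mul.
Proof.
move=> a; rewrite -(pi1_reprK a) /pi1_one; move: (pi1_repr a) => f.
rewrite pi1_classM; apply/pi1_classP.
apply: (@path_homotopic_reparam _ _ _ _ _ _ _ _ f
  (fun r => Num.min 1 (2 * r)) id) => //.
- by apply: min_cont; [exact: rcst_cont|exact: double_cont].
- by rewrite mulr0 min_r//; lra.
- by rewrite mulr1 min_l//; lra.
- move=> s; rewrite concatE'; set r := \val s; case: (leP r 2^-1) => r2.
    by rewrite min_r//; lra.
  by rewrite min_l ?clamp1 ?path_one//; lra.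
- by move=> s; rewrite clampK.
Qed.

Lemma pi1_mulV : left_inverse pi1_one pi1_inv pi1_mul.
Proof.
move=> a; rewrite -(pi1_reprK a) /pi1_one; move: (pi1_repr a) => f.
rewrite pi1_classV pi1_classM; apply/pi1_classP.
apply: (@path_homotopic_reparam _ _ _ _ _ _ _ _ f
  (fun r => Num.max (1 - 2 * r) (2 * r - 1)) (fun=> 1)) => //.
- by apply: max_cont; [apply: onem_cont; exact: double_cont|exact: double1_cont].
- exact: rcst_cont.
- by rewrite mulr0 max_l//; lra.
- by rewrite mulr1 max_r//; lra.
- move=> s; have /andP[s0 s1] := unit_itvP s; rewrite concatE'.
  set r := \val s in s0 s1 *; case: (leP r 2^-1) => r2.
    rewrite max_l; last lra.
    rewrite /path_reverse/= /mk_path /reverse_fun clampE//; lra.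
  by rewrite max_r//; lra.
- by move=> s; rewrite clamp1 path_one.
Qed.

Lemma pi1_mulVr : right_inverse pi1_one pi1_inv pi1_mul.
Proof.
move=> a; rewrite -(pi1_reprK a) /pi1_one; move: (pi1_repr a) => f.
rewrite pi1_classV pi1_classM; apply/pi1_classP.
apply: (@path_homotopic_reparam _ _ _ _ _ _ _ _ f
  (fun r => Num.min (2 * r) (1 - (2 * r - 1))) (fun=> 0)) => //.
- by apply: min_cont; [exact: double_cont|apply: onem_cont; exact: double1_cont].
- exact: rcst_cont.
- by rewrite mulr0 min_l//; lra.
- by rewrite mulr1 min_r//; lra.
- move=> s; have /andP[s0 s1] := unit_itvP s; rewrite concatE'.
  set r := \val s in s0 s1 *; case: (leP r 2^-1) => r2.
    by rewrite min_l//; lra.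
  rewrite min_r; last lra.
  rewrite /path_reverse/= /mk_path /reverse_fun clampE//; lra.
- by move=> s; rewrite clamp0 path_zero.
Qed.

HB.instance Definition _ := isGroup.Build pi1
  pi1_mulA pi1_mul1 pi1_mulr1 pi1_mulV pi1_mulVr.

End FundamentalGroup.

Section InducedMap.
Variables (R : realType) (X Y : topologicalType) (phi : continuousType X Y).
Variable x0 : X.

Definition pi1_map (a : pi1 R x0) : pi1 R (phi x0) :=
  pi1_class (phi \o pi1_repr a : {path unit_interval R from _ to _ in _}).

Lemma pi1_map_class (f : loop R x0) :
  pi1_map (pi1_class f) =
  pi1_class (phi \o f : {path unit_interval R from _ to _ in _}).
Proof.
apply/pi1_classP; have [H [cH H01 Hxy]] := pi1_repr_class f.
exists (phi \o H); split.
- by move=> u; apply: continuous_comp; [exact: cH|exact: cts_fun].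
- by move=> s; case: (H01 s) => /= -> ->.
- by move=> t; case: (Hxy t) => /= -> ->.
Qed.

End InducedMap.

Section SubsetInclusion.
Variables (X : topologicalType) (A B : set X) (AB : A `<=` B).

Definition set_incl (a : A) : B := SigSub (mem_set (AB (set_valP a))).

Lemma set_incl_continuous : continuous set_incl.
Proof. by apply/continuous_comp_initial; exact: initial_continuous. Qed.

HB.instance Definition _ :=
  isContinuous.Build A B set_incl set_incl_continuous.

End SubsetInclusion.

Section Embeddings.
Variables X Y : topologicalType.

Definition embedding (f : X -> Y) : Prop :=
  injective f /\
  forall A : set X, open A <-> exists2 B : set Y, open B & A = f @^-1` B.

Definition homeomorphism (f : X -> Y) : Prop :=
  exists g : Y -> X,
    [/\ continuous f, continuous g, cancel f g & cancel g f].

End Embeddings.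

Section Knots.
Variable R : realType.
Local Notation I := (unit_interval R).

Definition sqnorm n (x : 'rV[R]_n) : R := \sum_i x ord0 i ^+ 2.

Definition sphere n : set 'rV[R]_n.+1 := [set x | sqnorm x = 1].
Arguments sphere n _ : clear implicits.

Definition disk : set 'rV[R]_2 := [set x | sqnorm x <= 1].

Local Notation S1 := (set_type (sphere 1)).
Local Notation S3 := (set_type (sphere 3)).
Implicit Types K L V : set S3.

Definition knot K : Prop := exists2 k : S1 -> S3, embedding k & range k = K.

Definition ambient_isotopic K L : Prop :=
  exists H : I * S3 -> S3,
    [/\ continuous H,
        forall t, homeomorphism (fun x => H (t, x)),
        forall x, H (zero, x) = x &
        [set H (one, x) | x in K] = L].

Definition coord (x : S3) (i : nat) : R := (\val x : 'rV[R]_4) ord0 (inord i).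

(* Stereographic projection from the pole (0, 0, 0, 1). *)
Definition stereographic (x : S3) : 'rV[R]_3 :=
  \row_(i < 3) (coord x i / (1 - coord x 3)).

Definition segment (p q : 'rV[R]_3) : set 'rV[R]_3 :=
  [set (1 - t) *: p + t *: q | t in `[0, 1]%classic].

Definition closed_polygon (v : seq 'rV[R]_3) : set 'rV[R]_3 :=
  \bigcup_(e in [set` zip v (rot 1 v)]) segment e.1 e.2.

(* [closed_polygon v] may have self-intersections; those are excluded by
   [knot K]. *)
Definition polygonal_knot K : Prop :=
  [/\ knot K,
      forall x, K x -> coord x 3 != 1 &
      exists v, stereographic @` K = closed_polygon v].

Definition tame_knot K : Prop :=
  knot K /\ exists2 L, polygonal_knot L & ambient_isotopic K L.

Definition round_circle : set S3 :=
  [set x | coord x 2 = 0 /\ coord x 3 = 0].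

Definition trivial_knot K : Prop := ambient_isotopic K round_circle.

(* The embedding is defined on the open solid torus, and not only on the closed
   one, so that the boundary torus is not wild. *)
Definition tubular_neighbourhood K V : Prop :=
  exists e : S1 * 'rV[R]_2 -> S3,
    [/\ embedding e,
        [set e z | z in [set z | z.2 = 0]] = K &
        [set e z | z in [set z | disk z.2]] = V].

Definition knot_exterior V : set S3 := ~` interior V.

Definition boundary_torus V : set S3 := V `&` knot_exterior V.

Definition torus_incl V : boundary_torus V -> knot_exterior V :=
  set_incl (@subIsetr _ V (knot_exterior V)).

HB.instance Definition _ V := Continuous.on (@torus_incl V).

Definition knot_group V (x0 : boundary_torus V) : groupType :=
  pi1 R (torus_incl x0).

(* In a chart of S^3 around p, identified with R^2 x R, the sets K and D are
   the line 0 x R and the plane R^2 x 0. *)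
Definition transverse_at K (D : set S3) (p : S3) : Prop :=
  exists c : 'rV[R]_2 * R -> S3,
    [/\ embedding c, c (0, 0) = p,
        forall z, K (c z) <-> z.1 = 0 & forall z, D (c z) <-> z.2 = 0].

Definition meridian K V (x0 : boundary_torus V) (mu : pi1 R x0) : Prop :=
  exists2 gamma : loop R x0,
    pi1_class gamma = mu /\ {in [set~ one] &, injective gamma} &
    exists2 d : disk -> S3,
      [/\ embedding d, range d `<=` V &
          [set d u | u in [set u : disk | sqnorm (\val u) = 1]] =
          range (fun t => \val (gamma t))] &
      exists2 p, range d `&` K = [set p] & transverse_at K (range d) p.

End Knots.

Arguments sphere R n _ : clear implicits.

(* Main.v *)
Require Import Defs.
From mathcomp Require Import all_boot all_order all_algebra.
From mathcomp Require Import all_classical all_reals topology normedtype.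
Import numFieldNormedType.Exports.
Local Open Scope classical_set_scope.

(** Since [ramification] is by definition the normal closure of the inertia
    subgroups, the first equality holds by definition. The second is a general
    fact about a group [G] with canonical map [iota] to its profinite
    completion, a subgroup [U] of [G], and subsets [S i] of [U]: closing up
    commutes with generating a normal subgroup ([closure_normal_closure]). Write
    [N] for the normal closure of the [S i] in [U], and [Nhat] for the normal
    closure in [Uhat], the closure of [iota U], of the closures of the
    [iota (S i)].

    One inclusion is algebraic. The elements of [U] that [iota] sends into
    [Nhat] form a normal subgroup of [U] containing every [S i]
    ([normal_in_preimage]), hence containing [N]; so [iota N] lies in [Nhat],
    and it remains to take closures.

    The other one is topological. The closure of [iota N] is normal in the
    closure of [iota U] ([normal_in_closure]), because conjugation is continuous
    in the conjugated and in the conjugating element separately. This closure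
    contains those of the [iota (S i)], hence [Nhat], and it is closed. *)

Section NormalClosure.
Local Set Implicit Arguments.
Local Unset Strict Implicit.
Local Open Scope group_scope.
Variable G : groupType.
Implicit Types H N S U : set G.

(** Restates the boolean membership of [group_closed] with predicates, the form
    in which sets defined by closures and intersections are handled. *)
Lemma subgroupP H :
  subgroup H <-> H 1 /\ forall x y, H x -> H y -> H (x / y).
Proof.
split=> -[H1 HF]; split.
- exact: set_mem.
- by move=> x y Hx Hy; apply/set_mem/HF; exact: mem_set.
- exact: mem_set.
- by move=> x y /set_mem Hx /set_mem Hy; apply/mem_set/HF.
Qed.

Lemma subgroup_normal_in U : subgroup U -> normal_in U U.
Proof.
move=> gU; split=> // u n Uu Un.
have /subgroupP[U1 UF] := gU.
have UV x : U x -> U x^-1 by move=> Ux; rewrite -div1g; exact: UF.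
have UM x y : U x -> U y -> U (x * y).
  by move=> Ux Uy; rewrite -(invgK y); exact/UF/UV.
by rewrite conjgE; apply: (UM); [exact: UV|exact: UM].
Qed.

(** An intersection of normal subgroups of [U] is one, provided that there is at
    least one to intersect; here [U] itself, which is why [S] must lie in [U]. *)
Lemma normal_in_normal_closure U S :
  subgroup U -> S `<=` U -> normal_in U (normal_closure U S).
Proof.
move=> gU SU; split.
- apply/subgroupP; split=> [N [[/subgroupP[]]]//|x y Nx Ny N nN].
  have [[/subgroupP[_ NF] _ _] _] := nN.
  by apply: NF; [exact: Nx | exact: Ny].
- by apply: smallest_sub => //; exact: subgroup_normal_in.
- move=> u n Uu Nn N nN; have [[_ _ NJ] _] := nN.
  by apply: NJ => //; exact: Nn.
Qed.

End NormalClosure.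

Section ProfiniteTopology.
Local Set Implicit Arguments.
Local Unset Strict Implicit.
Local Open Scope group_scope.
Variable G : groupType.
Local Notation Ghat := (profinite_completion G).
Local Notation iota := (@to_profinite G).
Local Notation coset_product :=
  (prod_topology (fun M : finNormal G => coset_group M : topologicalType)).
Implicit Types (H N U S : set G) (x y z : Ghat).

(** The product topology is the supremum of the topologies induced by the
    projections, so convergence there gives convergence in the topology induced
    by the projection to [M]. This route, unlike [proj_continuous], works
    for an index type without decidable equality such as [finNormal G]. *)
Lemma coordinate_continuous (M : finNormal G) :
  continuous (fun x : Ghat => \val x M).
Proof.
have cval : continuous (\val : Ghat -> coset_product) by exact: initial_continuous.
move=> x; have FF := @fmap_filter _ _ \val (nbhs x) (nbhs_filter x).
have /(cvg_sup _ _ _)/(_ M) xM := cval x.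
apply: cvg_trans (cvg_app (proj M) xM) _.
exact: (@initial_continuous _ _ (proj M)).
Qed.

(** The finite quotients being discrete, each [phi M] is continuous whatever it
    is. All translations and conjugations of the completion have this form. *)
Lemma coordinatewise_continuous (f : Ghat -> Ghat)
    (phi : forall M : finNormal G, coset_group M -> coset_group M) :
  (forall x M, \val (f x) M = phi M (\val x M)) -> continuous f.
Proof.
move=> fphi; apply: continuous_comp_initial => x.
have FF := @fmap_filter _ _ (\val \o f) (nbhs x) (nbhs_filter x).
apply/cvg_sup => M.
have phi_cont : continuous (phi M).
  move=> c A /(nbhs_singleton (T := coset_group M)) phiA.
  exact/principal_filterP.
have : continuous (\val \o f : Ghat -> initial_topology (proj M)).
  apply: continuous_comp_initial.
  rewrite (_ : _ \o _ = phi M \o fun y : Ghat => \val y M).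
    move=> y; apply: continuous_comp; last exact: phi_cont.
    exact: coordinate_continuous.
  by apply/funext => y; exact: fphi.
exact.
Qed.

Lemma mulg_continuousl x : continuous (fun y => y * x).
Proof.
exact: (@coordinatewise_continuous _ (fun M c => c * \val x M)).
Qed.

Lemma divg_continuousr x : continuous (fun y => x / y).
Proof.
exact: (@coordinatewise_continuous _ (fun M c => \val x M / c)).
Qed.

Lemma conjg_continuousl x : continuous (fun y => y ^ x).
Proof.
exact: (@coordinatewise_continuous _ (fun M c => c ^ \val x M)).
Qed.

Lemma conjg_continuousr x : continuous (fun y => x ^ y).
Proof.
exact: (@coordinatewise_continuous _ (fun M c => \val x M ^ c)).
Qed.

Lemma closure_sub_preimage (f : Ghat -> Ghat) (A B : set Ghat) :
  continuous f -> closed B -> A `<=` f @^-1` B -> closure A `<=` f @^-1` B.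
Proof.
move=> cf cB AB; rewrite closureE; apply: smallest_sub => //.
by apply: preimage_closed.
Qed.

(** Separate continuity of division suffices: the set of [x] with [x / y] in the
    closure of [A] is closed, so it is enough to treat [x] in [A], and then
    likewise [y] in [A]. *)
Lemma subgroup_closure (A : set Ghat) : subgroup A -> subgroup (closure A).
Proof.
move=> /subgroupP[A1 AF]; apply/subgroupP; split; first exact: subset_closure.
move=> x y cx cy.
apply: (closure_sub_preimage (B := closure _)
  (@mulg_continuousl y^-1) _ _ cx).
  exact: closed_closure.
move=> {cx}x Ax; apply: (closure_sub_preimage (B := closure _)
  (@divg_continuousr x) _ _ cy).
  exact: closed_closure.
by move=> {cy}y Ay; apply: subset_closure; exact: AF.
Qed.

(** The conjugating element is moved from [closure A] to [A] first, then the
    conjugated one from [closure B] to [B], as in [subgroup_closure]. *)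
Lemma normal_in_closure (A B : set Ghat) :
  normal_in A B -> normal_in (closure A) (closure B).
Proof.
move=> [gB BA BJ]; split; first exact: subgroup_closure.
  exact: closureS.
move=> u n cu cn.
apply: (closure_sub_preimage (B := closure _)
  (@conjg_continuousr n) _ _ cu).
  exact: closed_closure.
move=> {cu}u Au; apply: (closure_sub_preimage (B := closure _)
  (@conjg_continuousl u) _ _ cn).
  exact: closed_closure.
by move=> {cn}n Bn; apply: subset_closure; exact: BJ.
Qed.

Lemma to_profiniteM (g h : G) :
  to_profinite (g * h) = to_profinite g * to_profinite h.
Proof. by apply: profinite_eqP => M; exact: coset_projM. Qed.

Lemma to_profiniteV (g : G) : to_profinite g^-1 = (to_profinite g)^-1.
Proof. by apply: profinite_eqP => M; exact: coset_projV. Qed.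

Lemma to_profiniteJ (g h : G) :
  to_profinite (g ^ h) = to_profinite g ^ to_profinite h.
Proof. by rewrite !conjgE !to_profiniteM to_profiniteV. Qed.

Lemma normal_in_image U N :
  normal_in U N -> normal_in (iota @` U) (iota @` N).
Proof.
move=> [/subgroupP[N1 NF] NU NJ]; split; last 2 first.
- exact: image_subset.
- move=> _ _ [u Uu <-] [n Nn <-].
  by exists (n ^ u); [exact: NJ|exact: to_profiniteJ].
- apply/subgroupP; split; first by exists 1.
  move=> _ _ [x Nx <-] [y Ny <-]; exists (x / y); first exact: NF.
  by rewrite to_profiniteM to_profiniteV.
Qed.

Lemma normal_in_preimage U (A B : set Ghat) :
  subgroup U -> iota @` U `<=` A -> normal_in A B ->
  normal_in U (U `&` iota @^-1` B).
Proof.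
move=> gU UA [/subgroupP[B1 BF] BA BJ]; have [_ _ UJ] := subgroup_normal_in gU.
have /subgroupP[U1 UF] := gU; split; last 2 first.
- exact: subIsetl.
- move=> u n Uu [Un Bn]; split; first exact: UJ.
  by rewrite /= to_profiniteJ; apply: BJ => //; apply: UA; exists u.
- apply/subgroupP; split=> // x y [Ux Bx] [Uy By]; split; first exact: UF.
  by rewrite /= to_profiniteM to_profiniteV; exact: BF.
Qed.

(** [profinite_sub U] is closed, so closing up inside it or in the whole
    completion is the same. *)
Lemma closure_in_profinite_sub U (A : set Ghat) :
  A `<=` profinite_sub U -> closure_in (profinite_sub U) A = closure A.
Proof.
move=> AU; rewrite /closure_in closure_subspaceW//; apply: setIidl.
have /closure_id -> : closed (profinite_sub U) by exact: closed_closure.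
exact: closureS.
Qed.

(** Normal generation commutes with closure. The family is indexed because the
    closure of a union of infinitely many [iota (S i)] may exceed the union of
    their closures; the outer closure on the right makes up for it. *)
Lemma closure_normal_closure U (I : Type) (S : I -> set G) :
  subgroup U -> (forall i, S i `<=` U) ->
  let cl (A : set Ghat) := closure_in (profinite_sub U) A in
  cl (iota @` normal_closure U (\bigcup_i S i)) =
  cl (normal_closure (profinite_sub U)
       (\bigcup_i cl (iota @` S i))).
Proof.
move=> gU SU cl.
set Uhat := profinite_sub U; set N := normal_closure U _.
set T := \bigcup_i _; set Nhat := normal_closure Uhat T.
have iU : iota @` U `<=` Uhat by exact: subset_closure.
have clE A : A `<=` U -> cl (iota @` A) = closure (iota @` A).
  move=> AU; apply: closure_in_profinite_sub.
  by apply: subset_trans iU; exact: image_subset.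
have /subgroup_normal_in nU := gU.
have gUhat : subgroup Uhat by case: (normal_in_closure (normal_in_image nU)).
have TUhat : T `<=` Uhat.
  apply: bigcup_sub => i _; rewrite clE//; apply: closureS.
  exact: image_subset.
have nN : normal_in U N.
  by apply: normal_in_normal_closure => //; exact: bigcup_sub.
have nNhat := normal_in_normal_closure gUhat TUhat.
have [[_ NU _] [_ NhatU _]] := (nN, nNhat).
rewrite clE// [RHS]closure_in_profinite_sub//.
apply/seteqP; split.
- apply: closureS => _ [n Nn <-].
  (* [iota] sends [N] into [Nhat], by minimality of [N]. *)
  suff : N `<=` U `&` iota @^-1` Nhat by move=> /(_ _ Nn)[].
  apply: smallest_sub; first exact: (@normal_in_preimage U Uhat).
  move=> s [i _ Ss]; split; first exact: (SU i).
  apply: sub_gen_smallest; exists i => //; rewrite clE//.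
  by apply: subset_closure; exists s.
(* [Nhat] lies in the closure of [iota N], by minimality of [Nhat]. *)
- have /closure_id -> : closed (closure (iota @` N)).
    exact: closed_closure.
  apply: closureS; apply: smallest_sub.
    by apply: normal_in_closure; exact: normal_in_image.
  apply: bigcup_sub => i _; rewrite clE//; apply/closureS/image_subset.
  by move=> s Ss; apply: sub_gen_smallest; exists i.
Qed.

End ProfiniteTopology.

Theorem proposition4p3 (R : realType) (K V : set (sphere R 3))
    (tameK : tame_knot K) (nontrivialK : ~ trivial_knot K)
    (nuV : tubular_neighbourhood K V)
    (x0 : boundary_torus V) (mu : pi1 R x0) (meridian_mu : meridian K mu)
    (U : set (knot_group x0)) (subU : subgroup U) (finU : finite_index U) :
  let m : knot_group x0 := pi1_map (@torus_incl R V) mu in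
  let Uhat : set (profinite_completion (knot_group x0)) := profinite_sub U in
  let cl (H : set (knot_group x0)) := closure_in Uhat (@to_profinite _ @` H) in
  cl (ramification m U) =
    cl (normal_closure U (\bigcup_(g : knot_group x0) inertia m U g)) /\
  cl (normal_closure U (\bigcup_(g : knot_group x0) inertia m U g)) =
    closure_in Uhat
      (normal_closure Uhat (\bigcup_(g : knot_group x0) cl (inertia m U g))).
Proof.
move=> m Uhat cl; split; first by [].
by apply: closure_normal_closure => // g; exact: subIsetl.
Qed.
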